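(* Let $\phi \in L^{\infty}(\mathbb{R})$ and let $f \in L^1(\mathbb{R})$ satisfy $\hat{f}(0) = 1$. If \[\lim_{x \to \infty}\int_{-\infty}^{\infty}\phi(t)f(x-t)dt = \alpha,\] then $P(\phi) = \alpha$.
   Context: All functions are real-valued. $\hat{f}(\xi) = \int_{-\infty}^{\infty} f(x)e^{-i\xi x}dx$. For $\phi \in L^{\infty}(\mathbb{R})$, \[\overline{P}(\phi) = \lim_{\theta \to \infty}\limsup_{x \to \infty}\frac{1}{\theta}\int_x^{x+\theta}\phi(t)dt, \qquad \underline{P}(\phi) = -\overline{P}(-\phi) = \lim_{\theta \to \infty}\liminf_{x \to \infty}\frac{1}{\theta}\int_x^{x+\theta}\phi(t)dt,\] and $P(\phi) = \alpha$ means, by definition, that $\overline{P}(\phi) = \underline{P}(\phi) = \alpha$. *)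

(* Defs.v *)
From mathcomp Require Import all_boot all_order all_algebra.
From mathcomp Require Import all_classical all_reals all_analysis.
From mathcomp Require Import complex.
Set Implicit Arguments.
Unset Strict Implicit.
Unset Printing Implicit Defensive.
Import Order.TTheory GRing.Theory Num.Theory.
Import numFieldNormedType.Exports.
Local Open Scope classical_set_scope.
Local Open Scope ring_scope.

Definition cintegral (R : realType) (g : R -> R[i]) : R[i] :=
  (\int[lebesgue_measure]_x complex.Re (g x) +i*
   \int[lebesgue_measure]_x complex.Im (g x))%C.

Definition expi (R : realType) (t : R) : R[i] := (cos t +i* sin t)%C.

Definition fourier (R : realType) (f : R -> R) (xi : R) : R[i] :=
  cintegral (fun x => (f x)%:C%C * expi (- (xi * x))).

Definition window_mean (R : realType) (phi : R -> R) (theta x : R) : R :=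
  theta^-1 * \int[lebesgue_measure]_(t in `[x, x + theta]) phi t.

Definition upper_mean (R : realType) (phi : R -> R) (theta : R) : \bar R :=
  limf_esup (fun x => (window_mean phi theta x)%:E) +oo%R.

Definition upper_P (R : realType) (phi : R -> R) : \bar R :=
  lim (upper_mean phi theta @[theta --> +oo%R]).

Definition lower_P (R : realType) (phi : R -> R) : \bar R :=
  (- upper_P (\- phi)%R)%E.

(* [lim] is a total operator, so the existence of both limits is required
   explicitly. *)
Definition has_P (R : realType) (phi : R -> R) (alpha : R) : Prop :=
  [/\ cvg (upper_mean phi theta @[theta --> +oo%R]),
      cvg (upper_mean (\- phi)%R theta @[theta --> +oo%R]),
      upper_P phi = alpha%:E & lower_P phi = alpha%:E].

(* Main.v *)
Require Import Defs.
From mathcomp Require Import all_boot all_order all_algebra.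
From mathcomp Require Import all_classical all_reals all_analysis.
From mathcomp Require Import measurable_realfun complex.
From mathcomp Require Import ring lra.
Import Order.TTheory GRing.Theory Num.Theory.
Import numFieldNormedType.Exports.
Local Open Scope classical_set_scope.
Local Open Scope ring_scope.

(** Write [g = phi * f] and [W y] for the integral of [phi] over
    [[y, y + theta]].  By Fubini, the integral of [g] over [[x, x + theta]] is
    the integral of [f u * W (x - u)] in [u].  Moving the window by [u] changes
    [W] by at most [2 M min (|u|, theta)], so, since [f] has integral [1], the
    mean of [g] and the mean of [phi] over [[x, x + theta]] differ by at most
    the integral of [|f u| 2 M min (|u| / theta, 1)].  This bound does not
    depend on [x] and tends to [0] as [theta] grows, by dominated
    convergence. *)

Section lemmas.
Context {R : realType}.
Notation mu := (@lebesgue_measure R).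
Implicit Types (f g h phi : R -> R) (a b : R).

(** * Reflections and translations under the Lebesgue integral *)

Let subl a : measurableTypeR R -> measurableTypeR R := fun x => a - x.

Let measurable_subl a : measurable_fun setT (subl a).
Proof. exact: (@measurable_funB _ _ R setT (cst a) id). Qed.

(** By uniqueness of Lebesgue measure it is enough to test on the intervals []u, v]]. The preimage
    has its closed and open ends exchanged, but the same length. *)
Lemma lebesgue_measure_reflect a (A : set R) : measurable A ->
  pushforward mu (subl a) A = mu A.
Proof.
move=> mA; apply/esym; apply: lebesgue_measure_unique => //= _ [[u v]] _ <-.
rewrite /pushforward.
have -> : subl a @^-1` `]u, v] = [set` `[a - v, a - u[ ].
  apply/seteqP; split=> x /=; rewrite !in_itv/= /subl => /andP[? ?];
    by apply/andP; split; lra.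
rewrite !lebesgue_measure_itv/= !lte_fin ltrD2l ltrN2.
by case: ifP => // _; rewrite -!EFinB; congr EFin; ring.
Qed.

Lemma integrable_reflect a h : mu.-integrable setT (EFin \o h) ->
  mu.-integrable setT (EFin \o (fun x => h (a - x))).
Proof.
move=> /integrableP[mh ih]; have mr := @measurable_subl a.
apply/integrableP; split.
  exact: (measurableT_comp mh mr).
apply: le_lt_trans ih.
have mah : measurable_fun setT (abse \o (EFin \o h)) by exact: measurableT_comp.
have := ge0_integral_pushforward mr mu measurableT mah.
move=> /(_ (fun _ _ => abse_ge0 _)) E.
rewrite -[leLHS]E (eq_measure_integral mu)// => A mA _.
exact: lebesgue_measure_reflect.
Qed.

Lemma Rintegral_reflect a h : mu.-integrable setT (EFin \o h) ->
  \int[mu]_x h (a - x) = \int[mu]_x h x.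
Proof.
move=> ih; have mr := @measurable_subl a; congr fine.
have mh : measurable_fun setT (EFin \o h) by case/integrableP : ih.
have := integral_pushforward mr mh (integrable_reflect a h ih) measurableT.
rewrite preimage_setT => <-.
apply: eq_measure_integral => // A mA _.
exact: lebesgue_measure_reflect.
Qed.

Lemma integrable_translate a h : mu.-integrable setT (EFin \o h) ->
  mu.-integrable setT (EFin \o (fun x => h (x - a))).
Proof.
(* A translation is a composite of two reflections: [- a - (0 - x) = x - a]. *)
move=> /(integrable_reflect (- a)) /(integrable_reflect 0).
by apply: eq_integrable => // x _ /=; congr (h _)%:E; ring.
Qed.

Lemma Rintegral_translate a h : mu.-integrable setT (EFin \o h) ->
  \int[mu]_x h (x - a) = \int[mu]_x h x.
Proof.
move=> ih; have ih' := integrable_reflect (- a) h ih.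
rewrite -(Rintegral_reflect (- a) h ih) -(Rintegral_reflect 0 _ ih').
by apply: eq_Rintegral => x _; congr h; ring.
Qed.

(* No integrability is needed: if both parts are infinite, both sides are 0. *)
Lemma RintegralN h : \int[mu]_x - h x = - \int[mu]_x h x.
Proof.
rewrite /Rintegral integralE [in RHS]integralE.
have -> : (fun x => (- h x)%:E) = (\- (EFin \o h))%E by [].
rewrite funeposN funenegN.
by case: integral => [a||]; case: integral => [b||] //=; rewrite ?oppr0// opprB.
Qed.

(** * Limit superior at infinity and elementary estimates *)

Lemma ae_imp (P Q : R -> Prop) : (forall x, P x -> Q x) ->
  {ae mu, forall x, P x} -> {ae mu, forall x, Q x}.
Proof.
by move=> PQ; apply: filterS; first exact: (ae_filter_ringOfSetsType mu).
Qed.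

(** No limit of [w] is assumed. Every neighbourhood of [+oo] meets the set where [w] is within
    [c + e] of [a], which bounds each supremum from below; that set is itself such a neighbourhood,
    which bounds the infimum of the suprema from above. *)
Lemma limf_esup_close (w : R -> R) (a c : R) :
  (forall e, 0 < e -> \forall x \near +oo, `|w x - a| <= c + e) ->
  ((a - c)%:E <= limf_esup (fun x => (w x)%:E) +oo%R <= (a + c)%:E)%E.
Proof.
move=> wa; rewrite limf_esupE; apply/andP; split.
- apply/ereal_infP => _ [V Vy <-]; apply/lee_addgt0Pr => e e0.
  have [x [Vx wx]] := @filter_ex _ _ _ _ (filterI Vy (wa _ e0)).
  rewrite -leeBlDr//; apply: le_ereal_sup_tmp.
  exists (w x)%:E; first by exists x.
  by rewrite -EFinB lee_fin; move: wx; rewrite ler_norml => /andP[? ?]; lra.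
- apply/lee_addgt0Pr => e e0; apply: ge_ereal_inf.
  exists (ereal_sup ((fun x => (w x)%:E) @` [set x | `|w x - a| <= c + e])).
    by exists [set x | `|w x - a| <= c + e] => //; exact: wa e0.
  apply: ge_ereal_sup => _ [x /= wx <-]; rewrite -EFinD lee_fin.
  by move: wx; rewrite ler_norml => /andP[? ?]; lra.
Qed.

Let close_div (t c w a d e : R) : 0 < t ->
  `|c - t * w| <= t * d -> `|c - t * a| <= t * e -> `|w - a| <= d + e.
Proof.
move=> t0 cw ca; rewrite -(ler_pM2l t0) -[X in X * `|_|](gtr0_norm t0) -normrM.
move: cw ca; rewrite !ler_norml => /andP[? ?] /andP[? ?].
by apply/andP; split; lra.
Qed.

Let itv_lty (b1 b2 : bool) a b :
  (mu [set` Interval (BSide b1 a) (BSide b2 b)] < +oo)%E.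
Proof.
by rewrite lebesgue_measure_itv /=; case: ifP => // _; rewrite -EFinB ltry.
Qed.

Let integrable_cst_itv (b1 b2 : bool) a b (c : R) :
  mu.-integrable [set` Interval (BSide b1 a) (BSide b2 b)] (EFin \o cst c).
Proof.
apply: measurable_bounded_integrable => //; first exact: itv_lty.
by exists `|c|; split; [exact: num_real|move=> r cr y _ /=; exact: ltW].
Qed.

(** * Window integrals of a bounded function *)

Section bounded.
Variables (phi : R -> R) (M : R).
Hypotheses (mphi : measurable_fun setT phi) (phiM : forall x, `|phi x| <= M).

Lemma bounded_integrable (D : set R) : measurable D -> (mu D < +oo)%E ->
  mu.-integrable D (EFin \o phi).
Proof.
move=> mD Doo; apply: measurable_bounded_integrable => //.
  exact: measurable_funTS.
exists M; split; first exact: num_real.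
by move=> x Mx y _ /=; exact: le_trans (ltW Mx).
Qed.

Lemma bounded_integrable_itv (b1 b2 : bool) a b :
  mu.-integrable [set` Interval (BSide b1 a) (BSide b2 b)] (EFin \o phi).
Proof. by apply: bounded_integrable => //; exact: itv_lty. Qed.

Lemma Rintegral_itv_le (b1 b2 : bool) a b : a <= b ->
  `|\int[mu]_(x in [set` Interval (BSide b1 a) (BSide b2 b)]) phi x|
    <= M * (b - a).
Proof.
move=> ab; have iphi := bounded_integrable_itv b1 b2 a b.
apply: (le_trans (le_normr_Rintegral _ _)) => //.
apply: le_trans.
  by apply: (@le_Rintegral _ _ _ mu _ _ (cst M)) => //; exact: integrable_norm.
rewrite Rintegral_cst//.
have E : mu [set` Interval (BSide b1 a) (BSide b2 b)] = (b - a)%:E.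
  rewrite lebesgue_measure_itv /= lte_fin -EFinB; case: ifPn => //.
  by rewrite -leNgt => ba; congr EFin; lra.
by rewrite [X in fine X]E.
Qed.

Let W theta y := \int[mu]_(t in `[y, y + theta]) phi t.

(** For [y <= z], both windows are compared with [[y, z + theta]]. They leave out pieces of length
    [z - y] at opposite ends, each contributing at most [M * (z - y)]. No case distinction on
    whether the windows overlap is needed. *)
Lemma window_lipschitz theta y z : 0 <= theta ->
  `|W theta y - W theta z| <= 2 * M * `|y - z|.
Proof.
move=> t0; wlog yz : y z / y <= z.
  move=> H; case: (leP y z) => [|/ltW zy]; first exact: H.
  by rewrite distrC (distrC y); exact: H.
have i := bounded_integrable_itv true false y (z + theta).
have e1 := @Rintegral_itvB _ phi (BLeft y) (BRight (z + theta)) (y + theta) i.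
have e2 := @Rintegral_itvB _ phi (BLeft y) (BRight (z + theta)) z i.
have {}e1 := e1 ltac:(rewrite bnd_simp; lra) ltac:(rewrite bnd_simp; lra).
have {}e2 := e2 ltac:(rewrite bnd_simp; lra) ltac:(rewrite bnd_simp; lra).
rewrite Rintegral_itv_obnd_cbnd in e2; last exact: bounded_integrable_itv.
have b1 := Rintegral_itv_le false false (y + theta) (z + theta) ltac:(lra).
have b2 := Rintegral_itv_le true false y z yz.
rewrite -e1 in b1; rewrite /W -e2.
rewrite (distrC y) (ger0_norm (_ : 0 <= z - y)) ?subr_ge0//.
move: b1 b2; rewrite !ler_norml => /andP[? ?] /andP[? ?]; apply/andP; split; lra.
Qed.

Lemma window_bound theta y : 0 <= theta -> `|W theta y| <= M * theta.
Proof.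
move=> t0; have := Rintegral_itv_le true false y (y + theta) ltac:(lra).
by rewrite addrAC subrr add0r.
Qed.

(** * The convolution and Fubini's theorem *)

Variable f : R -> R.
Hypothesis intf : mu.-integrable setT (EFin \o f).

Let mf : measurable_fun setT f.
Proof. by case/integrableP : intf => /measurable_EFinP. Qed.

Lemma integrable_convolution x :
  mu.-integrable setT (EFin \o (fun t => phi t * f (x - t))).
Proof.
have if' := integrable_reflect x f intf.
apply: (@le_integrable _ _ _ mu _ measurableT _
  (fun t => (M * f (x - t))%:E)) => //.
- apply/measurable_EFinP; apply: measurable_funM => //.
  by case/integrableP : if' => /measurable_EFinP.
- move=> t _ /=; rewrite lee_fin !normrM ler_wpM2r//.
  exact: le_trans (phiM t) (ler_norm _).
- exact: (integrableZl _ M if').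
Qed.

Let I theta x : set R := `[x, x + theta]%classic.

Let measurable_I theta x : measurable (I theta x : set (measurableTypeR R)).
Proof. exact: measurable_itv. Qed.

Let measurable_indic_I theta x : measurable_fun setT (\1_(I theta x) : R -> R).
Proof. by apply: measurable_indic; exact: measurable_itv. Qed.

Let integrable_indic_I theta x c :
  mu.-integrable setT (EFin \o (fun s => \1_(I theta x) s * c)).
Proof.
apply: (@eq_integrable _ _ _ mu _ measurableT (EFin \o (cst c \_ (I theta x)))).
  by move=> s _; rewrite /= patchE indicE; case: ifP; rewrite ?mul1r ?mul0r.
rewrite -restrict_EFin; apply/(integrable_mkcond _ (measurable_I _ _)).
exact: integrable_cst_itv.
Qed.

(** The integrand after the substitution [u = s - t]: [f] now depends on [u] alone, so integrating
    in [s] first leaves a shifted window of [phi]. The indicator lets both integrals run over the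
    whole line. *)
Let H theta x (p : measurableTypeR R * measurableTypeR R) : R :=
  \1_(I theta x) p.1 * (phi (p.1 - p.2) * f p.2).

Let measurable_H theta x : measurable_fun setT (H theta x).
Proof.
apply: measurable_funM.
  exact: (measurableT_comp (measurable_indic_I theta x) measurable_fst).
apply: measurable_funM; last exact: (measurableT_comp mf).
apply: (measurableT_comp mphi).
exact: (@measurable_funB _ _ R setT fst snd).
Qed.

(** By Tonelli: for fixed [s], the integral of the absolute value in [u] is at most [M * c] on the
    window and [0] off it, where [c] is the [L^1] norm of [f]; the window has finite length. *)
Let integrable_H theta x :
  (mu \x mu)%E.-integrable setT (EFin \o H theta x).
Proof.
have mH := measurable_H theta x.
apply/integrable12ltyP; first exact/measurable_EFinP.
pose c := \int[mu]_u `|f u|.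
have c0 : 0 <= c by exact: Rintegral_ge0.
have M0 : 0 <= M by exact: le_trans (phiM 0).
have inf' := integrable_norm intf.
have iI := integrable_indic_I theta x (M * c).
apply: (@le_lt_trans _ _ (\int[mu]_s (\1_(I theta x) s * (M * c))%:E)%E).
  apply: ge0_le_integral => //=.
  - by move=> s _; exact: integral_ge0.
  - apply: (measurable_fun_fubini_tonelli_F (abse \o (EFin \o H theta x))).
      by apply: measurableT_comp => //; exact/measurable_EFinP.
    by move=> p; exact: abse_ge0.
  - by case/integrableP : iI.
  - move=> s _; set k := \1_(I theta x) s.
    have k0 : 0 <= k by rewrite /k indicE.
    have ik : mu.-integrable setT (EFin \o (fun u => k * M * `|f u|)).
      exact: (integrableZl _ (k * M) inf').
    have -> : (k * (M * c))%:E = (\int[mu]_u (k * M * `|f u|)%:E)%E.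
      by rewrite mulrA -RintegralZl// fineK//; exact: integrable_fin_num.
    apply: ge0_le_integral => //=.
    + apply/measurable_EFinP; apply: measurableT_comp => //.
      exact: (measurable_fun_pair2 s mH).
    + by case/integrableP : ik.
    + move=> u _; rewrite lee_fin /H /= !normrM -/k (ger0_norm k0) -mulrA.
      by rewrite ler_wpM2l// ler_wpM2r.
have /integrableP[_] := iI; apply: le_lt_trans; apply: ge0_le_integral => //=.
- by move=> s _; rewrite lee_fin indicE !mulr_ge0.
- by case/integrableP : iI.
- by case/integrableP : (integrable_norm iI).
- by move=> s _; rewrite lee_fin ler_norm.
Qed.

Let g x := \int[mu]_t (phi t * f (x - t)).

(** The reflection [u = s - t] brings the inner integral back to the convolution [g s]. *)
Let fubini_left theta x s :
  (\int[mu]_u (H theta x (s, u))%:E)%E = ((g \_ (I theta x)) s)%:E.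
Proof.
have i1 := integrable_convolution s.
have gE : g s = \int[mu]_u (phi (s - u) * f u).
  transitivity (\int[mu]_u (phi (s - u) * f (s - (s - u)))).
    exact/esym/(Rintegral_reflect s _ i1).
  by apply: eq_Rintegral => u _; rewrite subKr.
have i2 : mu.-integrable setT (EFin \o (fun u => phi (s - u) * f u)).
  move: (integrable_reflect s _ i1); apply: eq_integrable => // u _ /=.
  by congr (_ * f _)%:E; ring.
rewrite -[LHS]fineK; last first.
  apply: integrable_fin_num => //; rewrite /H/=.
  exact: (integrableZl _ (\1_(I theta x) s) i2).
congr EFin; rewrite -/(Rintegral mu setT (fun u => H theta x (s, u))) /H/=.
rewrite RintegralZl// -gE patchE indicE.
by case: ifP; rewrite ?mul1r ?mul0r.
Qed.

(** [s] lies in [[x, x + theta]] exactly when [s - u] lies in [[x - u, x - u + theta]], so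
    translating by [u] moves the window. *)
Let fubini_right theta x u :
  (\int[mu]_s (H theta x (s, u))%:E)%E = (f u * W theta (x - u))%:E.
Proof.
pose h := phi \_ (I theta (x - u)).
have ih : mu.-integrable setT (EFin \o h).
  rewrite /h -restrict_EFin; apply/(integrable_mkcond _ (measurable_I _ _)).
  exact: (bounded_integrable_itv true false).
have hE s : H theta x (s, u) = f u * h (s - u).
  rewrite /H/= /h patchE indicE /I !mem_setE !in_itv/=.
  rewrite lerBlDr subrK lerBlDr addrAC subrK.
  by case: ifP; rewrite ?(mul1r, mul0r, mulr0)// mulrC.
under eq_integral do rewrite hE.
have ih' := integrable_translate u h ih.
rewrite -[LHS]fineK; last first.
  by apply: integrable_fin_num => //; exact: (integrableZl _ (f u) ih').
congr EFin; rewrite -/(Rintegral mu setT (fun s => f u * h (s - u))).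
rewrite RintegralZl//; congr (f u * _).
by rewrite [LHS](Rintegral_translate u h ih) /W [RHS]Rintegral_mkcond.
Qed.

(** Fubini gives measurability as well as integrability here: [g] cut off to the window is a
    marginal of [H]. *)
Lemma integrable_window_convolution theta x :
  mu.-integrable `[x, x + theta] (EFin \o g).
Proof.
apply/(integrable_mkcond _ (measurable_I _ _)); rewrite restrict_EFin.
apply: eq_integrable (integrable_fubini_F (integrable_H theta x)) => // s _.
exact: fubini_left.
Qed.

Lemma integrable_convolution_window theta x : 0 <= theta ->
  mu.-integrable setT (EFin \o (fun u => f u * W theta (x - u))).
Proof.
move=> t0; have iM := integrableZl measurableT (M * theta) intf.
apply: (le_integrable _ _ _ iM) => //.
- have := measurable_fubini_G (integrable_H theta x).
  by apply: eq_measurable_fun => // u _; exact: fubini_right.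
- move=> u _; rewrite lee_fin !normrM mulrC ler_wpM2r//.
  rewrite -normrM; apply: le_trans (ler_norm _); exact: window_bound.
Qed.

Lemma Rintegral_window_convolution theta x :
  \int[mu]_(s in `[x, x + theta]) g s = \int[mu]_u (f u * W theta (x - u)).
Proof.
rewrite Rintegral_mkcond /Rintegral; congr fine.
have L : (\int[mu]_s \int[mu]_u (EFin \o H theta x) (s, u) =
    \int[mu]_s ((g \_ (I theta x)) s)%:E)%E.
  by apply: eq_integral => s _; exact: fubini_left.
have R' : (\int[mu]_u \int[mu]_s (EFin \o H theta x) (s, u) =
    \int[mu]_u (f u * W theta (x - u))%:E)%E.
  by apply: eq_integral => u _; exact: fubini_right.
exact: (etrans (esym L) (etrans (Fubini (integrable_H theta x)) R')).
Qed.

(** * Comparison of the two means and decay of the bound *)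

Hypothesis f1 : \int[mu]_x f x = 1.

(** The Lipschitz bound for a shift by [u], capped by twice the trivial bound on a window. The cap
    keeps [|f u| * k theta u] integrable even when [u * f u] is not. *)
Let k (theta u : R) : R := Num.min (2 * M * `|u|) (2 * M * theta).

Let measurable_k theta : measurable_fun setT (k theta).
Proof. by apply: measurable_minr => //; exact: measurable_funM. Qed.

Let M0 : 0 <= M. Proof. exact: le_trans (phiM 0). Qed.

Let k_ge0 theta u : 0 <= theta -> 0 <= k theta u.
Proof. by move=> t0; rewrite /k le_min !mulr_ge0. Qed.

Let integrable_fk theta : 0 <= theta ->
  mu.-integrable setT (EFin \o (fun u => `|f u| * k theta u)).
Proof.
move=> t0; have iM := integrableZl measurableT (2 * M * theta) intf.
apply: (le_integrable _ _ _ iM) => //.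
- apply/measurable_EFinP; apply: measurable_funM; last exact: measurable_k.
  by apply: measurableT_comp => //.
- move=> u _; rewrite lee_fin !normrM normr_id mulrC ler_wpM2r//.
  rewrite ger0_norm ?k_ge0// -!normrM; apply: le_trans (ler_norm _).
  by rewrite /k ge_min lexx orbT.
Qed.

Lemma mean_convolution_close theta x : 0 <= theta ->
  `|\int[mu]_(s in `[x, x + theta]) g s - W theta x|
    <= \int[mu]_u (`|f u| * k theta u).
Proof.
move=> t0; have i1 := integrable_convolution_window theta x t0.
have i2 : mu.-integrable setT (EFin \o (fun u => f u * W theta x)).
  exact: (integrableZr measurableT (W theta x) intf).
have i3 := integrableB measurableT i1 i2.
rewrite Rintegral_window_convolution.
(* Since [f] has integral [1], [W theta x] is the integral of [f u * W theta x], and the difference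
   goes under a single integral. *)
rewrite -[X in _ - X]mul1r -f1 -RintegralZr// -RintegralB//.
apply: (le_trans (le_normr_Rintegral _ _)) => //.
apply: le_Rintegral => //; first exact: (integrable_norm i3).
  exact: integrable_fk.
move=> u _; rewrite -mulrBr normrM ler_wpM2l// /k le_min; apply/andP; split.
  apply: le_trans (window_lipschitz _ _ _ t0) _.
  by rewrite addrAC subrr add0r normrN.
apply: le_trans (ler_normB _ _) _.
have := window_bound theta x t0; have := window_bound theta (x - u) t0; lra.
Qed.

(* The norm around [theta] keeps [0 <= j <= 2 M] for every real [theta], so
   that dominated convergence applies to arbitrary sequences tending to +oo. *)
Let j (theta u : R) : R := Num.min (2 * M * `|u| * `|theta|^-1) (2 * M).

Let j_ge0 theta u : 0 <= j theta u.
Proof. by rewrite /j le_min !mulr_ge0// invr_ge0. Qed.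

Let kE theta u : 0 < theta -> k theta u = theta * j theta u.
Proof.
move=> t0; rewrite /k /j (gtr0_norm t0) minr_pMr ?ltW//.
congr Num.min; last by rewrite mulrC.
by field; rewrite gt_eqF.
Qed.

(** For [theta > 0], the bound of [mean_convolution_close] divided by [theta]. *)
Let D theta := \int[mu]_u (`|f u| * j theta u).

Let integrable_fj theta :
  mu.-integrable setT (EFin \o (fun u => `|f u| * j theta u)).
Proof.
have iM := integrableZl measurableT (2 * M) intf.
apply: (le_integrable _ _ _ iM) => //.
- apply/measurable_EFinP; apply: measurable_funM.
    by apply: measurableT_comp => //.
  by apply: measurable_minr => //; do 2 apply: measurable_funM => //.
- move=> u _; rewrite lee_fin !normrM normr_id mulrC ler_wpM2r//.
  rewrite ger0_norm// -normrM; apply: le_trans (ler_norm _).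
  by rewrite /j ge_min lexx orbT.
Qed.

Let D_cvg0 : D theta @[theta --> +oo] --> 0.
Proof.
(* Dominated convergence is applied along an arbitrary sequence [t n] tending to [+oo], with
   dominating function [2 * M * |f|]. *)
apply/cvg_pinftyP => t toy.
have iM := integrableZl measurableT (2 * M) (integrable_norm intf).
have mfj n : measurable_fun setT (fun u => (`|f u| * j (t n) u)%:E).
  by case/integrableP : (integrable_fj (t n)).
have ptw : {ae mu, forall u, setT u ->
    (`|f u| * j (t n) u)%:E @[n --> \oo] --> (0%R)%:E}.
  apply: aeW => u _; apply: cvg_EFin; first exact: nearW.
  apply: (@squeeze_cvgr _ _ _ _ (cst 0)
    (fun n => `|f u| * (2 * M * `|u| * `|t n|^-1))).
  - by apply: nearW => n /=; rewrite mulr_ge0//= ler_wpM2l// /j ge_min lexx.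
  - exact: cvg_cst.
  - rewrite -(mulr0 `|f u|); apply: cvgM; first exact: cvg_cst.
    rewrite -(mulr0 (2 * M * `|u|)); apply: cvgM; first exact: cvg_cst.
    (* Finitely many [t n] may vanish, where the inverse takes its default value [0]; only the tail
       matters. *)
    have t0 : \forall n \near \oo, 0 < `|t n|.
      move/cvgryPgt : toy => /(_ 0); apply: filterS => n /gt_eqF.
      by rewrite normr_gt0 => ->.
    apply/(gtr0_cvgV0 t0)/cvgryPge => A.
    move/cvgryPge : toy => /(_ A); apply: filterS => n /le_trans; apply.
    exact: ler_norm.
have dom : {ae mu, forall u n, setT u ->
    (`|(`|f u| * j (t n) u)%:E| <= (2 * M)%:E * (EFin \o (Num.norm \o f)) u)%E}.
  apply: aeW => u n _; rewrite lee_fin ger0_norm ?mulr_ge0// mulrC ler_wpM2r//.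
  by rewrite /j ge_min lexx orbT.
have [_ _] := @dominated_convergence _ _ _ mu _ measurableT _ (cst 0%E) _
  mfj (measurable_cst _) ptw iM dom.
by rewrite integral0 => /fine_cvg; exact.
Qed.

(** For each fixed [theta > 0], letting [x] grow makes the mean of [g] tend to [alpha], so the upper
    mean of [phi] is within [D theta] of [alpha]. Only then does [theta] grow, and [D theta]
    vanishes. *)
Lemma upper_mean_cvg (alpha : R) : g x @[x --> +oo] --> alpha ->
  upper_mean phi theta @[theta --> +oo] --> alpha%:E.
Proof.
move=> galpha.
apply: (@squeeze_cvge _ _ _ _ (fun theta => (alpha - D theta)%:E) _
  (fun theta => (alpha + D theta)%:E)).
- near=> theta.
  have t0 : 0 < theta by near: theta; exact: nbhs_pinfty_gt.
  apply: limf_esup_close => e e0.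
  (* For [x > A] the whole window lies beyond [A], so [g] is within [e] of [alpha] throughout it. *)
  have [A [_ gA]] : \forall x \near +oo, `|alpha - g x| <= e.
    by move/cvgrPdist_le : galpha => /(_ e e0).
  near=> x.
  have Ax : A < x by near: x; apply: nbhs_pinfty_gt; exact: num_real.
  have ig := integrable_window_convolution theta x.
  have ic c := integrable_cst_itv true false x (x + theta) c.
  have muI : mu `[x, x + theta]%classic = theta%:E.
    rewrite lebesgue_measure_itv /= lte_fin ltrDl t0 -EFinB.
    by congr EFin; ring.
  have cI (c : R) : \int[mu]_(s in `[x, x + theta]) c = theta * c.
    by rewrite Rintegral_cst// [X in fine X]muI mulrC.
  have near_alpha : `|\int[mu]_(s in `[x, x + theta]) g s - theta * alpha|
      <= theta * e.
    rewrite -(cI alpha) -(cI e) -RintegralB//; last exact: (ic alpha).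
    have igc := integrableB (measurable_I theta x) ig (ic alpha).
    apply: (le_trans (le_normr_Rintegral _ _)) => //.
    apply: le_Rintegral => //; [exact: (integrable_norm igc)|exact: ic|].
    move=> s /=; rewrite in_itv/= => /andP[xs _].
    by rewrite distrC; apply: gA; exact: lt_le_trans xs.
  have := mean_convolution_close theta x (ltW t0).
  have -> : \int[mu]_u (`|f u| * k theta u) = theta * D theta.
    rewrite -RintegralZl//; apply: eq_Rintegral => u _.
    by rewrite kE// mulrCA.
  have -> : W theta x = theta * window_mean phi theta x.
    by rewrite /window_mean mulrA divff ?gt_eqF// mul1r.
  by move=> close; exact: close_div t0 close near_alpha.
- apply: cvg_EFin; first exact: nearW.
  rewrite -[X in _ --> X]subr0; apply: cvgB => //; exact: cvg_cst.
- apply: cvg_EFin; first exact: nearW.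
  rewrite -[X in _ --> X]addr0; apply: cvgD => //; exact: cvg_cst.
Unshelve. all: by end_near.
Qed.

End bounded.

(** * From bounded to essentially bounded functions *)

Lemma upper_mean_ae_cvg phi f (M alpha : R) :
  measurable_fun setT phi -> {ae mu, forall x, `|phi x| <= M} ->
  mu.-integrable setT (EFin \o f) -> \int[mu]_x f x = 1 ->
  \int[mu]_t (phi t * f (x - t)) @[x --> +oo] --> alpha ->
  upper_mean phi theta @[theta --> +oo] --> alpha%:E.
Proof.
move=> mphi phiM intf f1 galpha.
(* [psi] is bounded everywhere and equals [phi] almost everywhere, so convolutions and window means
   agree. The bound is [|M|] since the sign of [M] is not given and [psi] may take the value [0]. *)
pose psi t := if `|phi t| <= M then phi t else 0.
have psiM x : `|psi x| <= `|M|.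
  rewrite /psi; case: ifPn => [/le_trans|_]; last by rewrite normr0.
  by apply; exact: ler_norm.
have mpsi : measurable_fun setT psi.
  apply: measurable_fun_ifT => //; apply: measurable_fun_ler => //.
  exact: measurableT_comp.
have psiE : {ae mu, forall x, phi x = psi x}.
  by apply: ae_imp phiM => x Mx; rewrite /psi Mx.
have convE x : \int[mu]_t (phi t * f (x - t)) = \int[mu]_t (psi t * f (x - t)).
  have mfx : measurable_fun setT (fun t : R => f (x - t)).
    by case/integrableP : (integrable_reflect x f intf) => /measurable_EFinP.
  congr fine; apply: ae_eq_integral => //.
  - by apply/measurable_EFinP; exact: measurable_funM.
  - by apply/measurable_EFinP; exact: measurable_funM.
  - by apply: ae_imp psiE => t -> _.
have windowE theta x : window_mean phi theta x = window_mean psi theta x.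
  congr (_ * fine _); apply: ae_eq_integral => //.
  - by apply/measurable_EFinP; exact: measurable_funTS.
  - by apply/measurable_EFinP; exact: measurable_funTS.
  - by apply: ae_imp psiE => t -> _.
have -> : upper_mean phi = upper_mean psi.
  apply/funext => theta; rewrite /upper_mean; congr limf_esup.
  by apply/funext => x; rewrite windowE.
apply: (upper_mean_cvg _ _ mpsi psiM _ intf f1).
by under eq_fun do rewrite -convE.
Qed.

End lemmas.

Theorem theorem5p5 (R : realType) (phi f : R -> R) (alpha : R)
    (phi_Loo : phi \in Lfun lebesgue_measure +oo%E)
    (f_L1 : f \in Lfun lebesgue_measure 1%E)
    (f_hat0 : fourier f 0 = 1)
    (phif_lim : (\int[lebesgue_measure]_t (phi t * f (x - t))) @[x --> +oo] --> alpha) :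
  has_P phi alpha.
Proof.
have intf := (Lfun1_integrable _ _).1 f_L1.
have f1 : \int[lebesgue_measure]_x f x = 1.
  have := congr1 (@complex.Re R) f_hat0; rewrite /fourier /cintegral /=.
  move=> <-; apply: eq_Rintegral => x _.
  by rewrite mul0r oppr0 cos0 sin0 /= mulr1 mul0r subr0.
have mphi : measurable_fun setT phi by case/andP : phi_Loo; rewrite inE.
have [M phiM] : exists M, {ae lebesgue_measure, forall x, `|phi x| <= M}.
  case/andP : phi_Loo => _; rewrite inE /= /finite_norm.
  (* The [L^oo] norm is an essential supremum only when the whole space has positive measure; the
     unit interval rules out the other case. *)
  rewrite unlock; case: ifPn => [_ /ess_sup_inf.ess_supr_bounded //|].
  rewrite -leNgt => mu0 _; exfalso; move: mu0; apply/negP; rewrite -ltNge.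
  apply: (@lt_le_trans _ _ (lebesgue_measure `[0, 1 : R]%classic)).
    by rewrite lebesgue_measure_itv /= lte_fin ltr01 -EFinB subr0 lte01.
  by apply: le_measure => //; rewrite inE.
have cphi := upper_mean_ae_cvg _ _ _ _ mphi phiM intf f1 phif_lim.
(* The lower mean is defined through [- phi], whose convolution with [f] tends to [- alpha]. *)
have cphiN : upper_mean (\- phi) theta @[theta --> +oo] --> (- alpha)%:E.
  apply: (upper_mean_ae_cvg _ f M) => //.
  - exact: measurableT_comp.
  - by apply: ae_imp phiM => x; rewrite normrN.
  - have -> : (fun x => \int[lebesgue_measure]_t ((\- phi) t * f (x - t))) =
        (fun x => - \int[lebesgue_measure]_t (phi t * f (x - t))).
      apply/funext => x; rewrite -RintegralN.
      by apply: eq_Rintegral => t _; rewrite mulNr.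
    exact: cvgN.
split.
- by apply/cvg_ex; exists alpha%:E.
- by apply/cvg_ex; exists (- alpha)%:E.
- exact: cvg_lim.
- by rewrite /lower_P /upper_P (cvg_lim _ cphiN)//= opprK.
Qed.
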